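(* Let $P$ be a set of $n$ points in the plane, $t>1$, $t'\ge t$, and let $k$ and $h$ be positive integers that are fixed (independent of $n$). Then the graph $H$ output by \textsc{Fast-Sparse-Spanner}$(P,t,t',k,h)$ is a geometric graph on $P$ with $O(n)$ edges.
   Context: All graphs are Euclidean: vertices are points and an edge $\{u,v\}$ has weight $|uv|$ (Euclidean distance). A $t$-path for $u,v$ in a graph $H$ is a path between $u$ and $v$ of total length at most $t|uv|$. Region quad-tree with leaf capacity $k$: the root corresponds to the bounding box of $P$; any node whose square contains more than $k$ points of $P$ is split into four equal quadrants (four children), recursively; nodes with at most $k$ points are leaves. The dual graph $G_T$ has the leaves of $T$ as vertices, two leaves adjacent iff their squares intersect. \textsc{FG-Greedy}$(Q,t)$ outputs the greedy $t$-spanner on $Q$: sort all pairs of $Q$ by distance; starting from the empty graph, for each pair $\{p,q\}$ in nondecreasing order, add edge $\{p,q\}$ if the current shortest-path distance between $p,q$ exceeds $t|pq|$. WSPD $t'$-spanner on a point set $S$: compute a well-separated pair decomposition $\{A_i,B_i\}_{i=1}^m$ of $S$ with separation ratio $s=4(t'+1)/(t'-1)$ (pairs of sets enclosed in congruent disjoint disks at distance at least $s$ times the common radius, such that every pair of distinct points is separated by exactly one pair), and add one edge $\{a_i,b_i\}$ with $a_i\in A_i,b_i\in B_i$ for each $i$; it has $O(|S|)$ edges. \textsc{Fast-Sparse-Spanner}$(P,t,t',k,h)$: (1) Build the quad-tree $T$ on $P$ with leaf capacity $k$; start with $H$ empty on $P$. (2) For every non-empty leaf $\sigma$, let $P_\sigma=P\cap\sigma$,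 add all edges of \textsc{FG-Greedy}$(P_\sigma,t)$ to $H$, and let the leader $\ell_\sigma$ be a point of $P_\sigma$ closest to the center of the bounding box of $P_\sigma$. (3) Add to $H$ the edges of a WSPD $t'$-spanner on the set of leaders. (4) For every pair of adjacent non-empty leaves $\sigma_i,\sigma_j$ of $G_T$ not yet merged, merge them. (5) For $i=2,\dots,h$, for every non-empty leaf $\sigma$ and every non-empty leaf $\sigma'$ at exactly $i$ hops from $\sigma$ in $G_T$, merge them if not yet merged. Merging $\sigma_i,\sigma_j$ with point sets $P_i,P_j$: process the pairs $(u,v)\in P_i\times P_j$ in some order (sorted by distance, or by a cheaper sorting heuristic), maintaining a set of ''bridges'' (paths in $H$ from a point of $P_i$ to a point of $P_j$, initialized possibly with the leader edge $\{\ell_{\sigma_i},\ell_{\sigma_j}\}$ if present); a pair is skipped if some bridge $x\leadsto y$ satisfies $t|ux|+|x\leadsto y|+t|yv|\le t|uv|$; otherwise a path from $u$ to $v$ in $H$ is sought, first by a greedy walk (repeatedly moving from the current vertex $y$ to an unvisited neighbor $x$ minimizing $|yx|+|xv|$), then by an $A^*$ shortest path computation; if a $t$-path is found it is added to the bridges, otherwise the edge $\{u,v\}$ is added to $H$ (and to the bridges). *)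

(* Defs.v *)
(* Formalization of Fast-Sparse-Spanner (P,t,t',k,h) as a
   relational (nondeterministic) semantics: [fss_output] relates an input
   point set to every graph that some admissible run of the algorithm can
   output. *)
From HB Require Import structures.
From mathcomp Require Import all_boot all_order all_algebra.
From mathcomp Require Import reals.
Set Implicit Arguments. Unset Strict Implicit. Unset Printing Implicit Defensive.
Import Order.TTheory GRing.Theory Num.Theory.
Local Open Scope ring_scope.

Section FSS.
Variable R : realType.

Definition pt := (R * R)%type.
Definition dist (p q : pt) : R :=
  Num.sqrt ((p.1 - q.1) ^+ 2 + (p.2 - q.2) ^+ 2).

Definition graph := seq (pt * pt).
Definition adj (E : graph) (p q : pt) : bool := ((p, q) \in E) || ((q, p) \in E).

Fixpoint walk_len (u : pt) (w : seq pt) : R :=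
  if w is x :: w' then dist u x + walk_len x w' else 0.

Definition has_path_len (E : graph) (u v : pt) (L : R) : Prop :=
  exists w : seq pt, [/\ path (adj E) u w, last u w = v & walk_len u w = L].

Definition sp_le (E : graph) (u v : pt) (c : R) : Prop :=
  exists L, has_path_len E u v L /\ L <= c.

Fixpoint pairs_of (Q : seq pt) : seq (pt * pt) :=
  if Q is x :: Q' then [seq (x, y) | y <- Q'] ++ pairs_of Q' else [::].

(* number of edges of the graph E on the vertex list P (P duplicate free) *)
Definition num_edges (P : seq pt) (E : graph) : nat :=
  count (fun pq => adj E pq.1 pq.2) (pairs_of P).

Definition geometric_graph_on (P : seq pt) (E : graph) : Prop :=
  forall e, e \in E -> [/\ e.1 \in P, e.2 \in P & e.1 != e.2].

Inductive greedy_run (t : R) : graph -> seq (pt * pt) -> graph -> Prop :=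
| GR_nil E : greedy_run t E [::] E
| GR_skip E p q L E' :
    sp_le E p q (t * dist p q) -> greedy_run t E L E' ->
    greedy_run t E ((p, q) :: L) E'
| GR_add E p q L E' :
    ~ sp_le E p q (t * dist p q) -> greedy_run t ((p, q) :: E) L E' ->
    greedy_run t E ((p, q) :: L) E'.

Definition fg_greedy (Q : seq pt) (t : R) (G : graph) : Prop :=
  exists L : seq (pt * pt),
    [/\ perm_eq L (pairs_of Q),
        sorted (fun a b : pt * pt => dist a.1 a.2 <= dist b.1 b.2) L &
        greedy_run t [::] L G].

Definition coord_min (P : seq pt) (f : pt -> R) : R :=
  foldr Num.min (f (head (0, 0) P)) (map f P).
Definition coord_max (P : seq pt) (f : pt -> R) : R :=
  foldr Num.max (f (head (0, 0) P)) (map f P).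

(* root square: the smallest axis-parallel square with lower-left corner
   (min x, min y) containing P *)
Definition root_x (P : seq pt) := coord_min P fst.
Definition root_y (P : seq pt) := coord_min P snd.
Definition root_side (P : seq pt) : R :=
  Num.max (coord_max P fst - coord_min P fst) (coord_max P snd - coord_min P snd).

(* a node of the (infinite) complete quad-tree: (depth d, (column i, row j)),
   with 0 <= i, j < 2^d; its square is
   [x0 + i s/2^d, x0 + (i+1) s/2^d] x [y0 + j s/2^d, y0 + (j+1) s/2^d] *)
Definition node := (nat * (nat * nat))%type.

(* index at depth d of the cell containing coordinate a (half-open cells,
   the last one closed) *)
Definition cell_index (P : seq pt) (a0 a : R) (d : nat) : nat :=
  let s := root_side P in
  if s == 0 then 0%N
  else minn (Num.truncn ((a - a0) / s * (2 ^ d)%N%:R)) (2 ^ d).-1%N.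

Definition in_node (P : seq pt) (σ : node) (p : pt) : bool :=
  (cell_index P (root_x P) p.1 σ.1 == σ.2.1) &&
  (cell_index P (root_y P) p.2 σ.1 == σ.2.2).

Definition node_pts (P : seq pt) (σ : node) : seq pt := filter (in_node P σ) P.

Definition ancestor (σ : node) (d' : nat) : node :=
  (d', ((σ.2.1 %/ 2 ^ (σ.1 - d'))%N, (σ.2.2 %/ 2 ^ (σ.1 - d'))%N)).

(* σ is a node of the region quad-tree T with leaf capacity k:
   every proper ancestor contains more than k points *)
Definition is_tree_node (P : seq pt) (k : nat) (σ : node) : bool :=
  [&& σ.2.1 < 2 ^ σ.1, σ.2.2 < 2 ^ σ.1 &
      all (fun d' => k < size (node_pts P (ancestor σ d'))) (iota 0 σ.1)]%N.

Definition is_leaf (P : seq pt) (k : nat) (σ : node) : bool :=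
  is_tree_node P k σ && (size (node_pts P σ) <= k)%N.

Definition nonempty_leaf (P : seq pt) (k : nat) (σ : node) : bool :=
  is_leaf P k σ && (0 < size (node_pts P σ))%N.

Definition sq_lo (P : seq pt) (a0 : R) (d i : nat) : R :=
  a0 + i%:R * root_side P / (2 ^ d)%N%:R.
Definition sq_hi (P : seq pt) (a0 : R) (d i : nat) : R :=
  a0 + i.+1%N%:R * root_side P / (2 ^ d)%N%:R.

Definition squares_meet (P : seq pt) (σ τ : node) : bool :=
  [&& sq_lo P (root_x P) σ.1 σ.2.1 <= sq_hi P (root_x P) τ.1 τ.2.1,
      sq_lo P (root_x P) τ.1 τ.2.1 <= sq_hi P (root_x P) σ.1 σ.2.1,
      sq_lo P (root_y P) σ.1 σ.2.2 <= sq_hi P (root_y P) τ.1 τ.2.2 &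
      sq_lo P (root_y P) τ.1 τ.2.2 <= sq_hi P (root_y P) σ.1 σ.2.2].

Definition GT_adj (P : seq pt) (k : nat) (σ τ : node) : bool :=
  [&& is_leaf P k σ, is_leaf P k τ, σ != τ & squares_meet P σ τ].

Definition GT_reach (P : seq pt) (k : nat) (m : nat) (σ τ : node) : Prop :=
  exists w : seq node, [/\ size w = m, path (GT_adj P k) σ w & last σ w = τ].

Definition GT_hops (P : seq pt) (k : nat) (σ τ : node) (m : nat) : Prop :=
  GT_reach P k m σ τ /\ forall m', (m' < m)%N -> ~ GT_reach P k m' σ τ.

Definition bbox_center (Q : seq pt) : pt :=
  ((coord_min Q fst + coord_max Q fst) / 2, (coord_min Q snd + coord_max Q snd) / 2).

Definition is_leader (Q : seq pt) (l : pt) : Prop :=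
  l \in Q /\ forall q, q \in Q -> dist l (bbox_center Q) <= dist q (bbox_center Q).

(* A and B are enclosed in congruent disjoint (closed) disks of radius r whose
   distance is at least s r *)
Definition well_separated (s : R) (A B : seq pt) : Prop :=
  exists (c1 c2 : pt) (r : R),
    [/\ 0 <= r, all (fun a => dist a c1 <= r) A, all (fun b => dist b c2 <= r) B,
        2 * r < dist c1 c2 & dist c1 c2 - 2 * r >= s * r].

Definition separates (p q : pt) (AB : seq pt * seq pt) : bool :=
  ((p \in AB.1) && (q \in AB.2)) || ((q \in AB.1) && (p \in AB.2)).

Definition is_wspd (s : R) (S : seq pt) (W : seq (seq pt * seq pt)) : Prop :=
  (forall AB, AB \in W ->
        [/\ AB.1 != [::], AB.2 != [::], {subset AB.1 <= S}, {subset AB.2 <= S}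
          & well_separated s AB.1 AB.2]) /\
      (forall p q, p \in S -> q \in S -> p != q -> count (separates p q) W = 1%N).

Definition wspd_spanner (t' : R) (S : seq pt) (W : seq (seq pt * seq pt)) (F : graph)
  : Prop :=
  is_wspd (4 * (t' + 1) / (t' - 1)) S W /\
  all2 (fun AB e => (e.1 \in AB.1) && (e.2 \in AB.2)) W F.

(* a bridge: a path in H from x to y, recorded with its length *)
Definition bridge := (pt * pt * R)%type.

Definition bridge_skips (t : R) (B : seq bridge) (u v : pt) : Prop :=
  exists b, b \in B /\ t * dist u b.1.1 + b.2 + t * dist b.1.2 v <= t * dist u v.

Inductive merge_run (t : R) : graph -> seq bridge -> seq (pt * pt) -> graph -> Prop :=
| MR_nil H B : merge_run t H B [::] H
| MR_skip H B u v L H' :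
    bridge_skips t B u v -> merge_run t H B L H' ->
    merge_run t H B ((u, v) :: L) H'
| MR_path H B u v L Lp H' :
    ~ bridge_skips t B u v ->
    has_path_len H u v Lp -> Lp <= t * dist u v ->
    merge_run t H (((u, v), Lp) :: B) L H' ->
    merge_run t H B ((u, v) :: L) H'
| MR_edge H B u v L H' :
    ~ bridge_skips t B u v -> ~ sp_le H u v (t * dist u v) ->
    merge_run t ((u, v) :: H) (((u, v), dist u v) :: B) L H' ->
    merge_run t H B ((u, v) :: L) H'.

Definition merge_step (t : R) (Pi Pj : seq pt) (li lj : pt) (H H' : graph) : Prop :=
  exists (B0 : seq bridge) (L : seq (pt * pt)),
    [/\ B0 = [::] \/ (adj H li lj /\ B0 = [:: ((li, lj), dist li lj)]),
        perm_eq L [seq (u, v) | u <- Pi, v <- Pj] &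
        merge_run t H B0 L H'].

Inductive merges_run (t : R) (P : seq pt) (lead : node -> pt)
  : graph -> seq (node * node) -> graph -> Prop :=
| MS_nil H : merges_run t P lead H [::] H
| MS_cons H H1 H' σ τ M :
    merge_step t (node_pts P σ) (node_pts P τ) (lead σ) (lead τ) H H1 ->
    merges_run t P lead H1 M H' ->
    merges_run t P lead H ((σ, τ) :: M) H'.

Definition same_unordered (στ : node * node) (a : node * node) : bool :=
  (a == στ) || (a == (στ.2, στ.1)).

(* H is a possible output of Fast-Sparse-Spanner(P,t,t',k,h), for a run in
   which the WSPD computed in step (3) has at most cW * |S| pairs *)
Definition fss_output (t t' : R) (k h : nat) (cW : R) (P : seq pt) (H : graph)
  : Prop :=
  exists (NL : seq node) (lead : node -> pt) (G : node -> graph)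
         (W : seq (seq pt * seq pt)) (F : graph) (M : seq (node * node)),
    [/\
      uniq NL /\ (forall σ, σ \in NL = nonempty_leaf P k σ),
      (forall σ, σ \in NL ->
          fg_greedy (node_pts P σ) t (G σ) /\ is_leader (node_pts P σ) (lead σ)),
      wspd_spanner t' (undup [seq lead σ | σ <- NL]) W F /\
      (size W)%:R <= cW * (size (undup [seq lead σ | σ <- NL]))%:R,
      [/\ forall στ, στ \in M ->
            [/\ στ.1 \in NL, στ.2 \in NL, στ.1 != στ.2 &
                exists m, (1 <= m <= h)%N /\ GT_hops P k στ.1 στ.2 m],
          forall σ τ m, σ \in NL -> τ \in NL -> σ != τ -> (1 <= m <= h)%N ->
            GT_hops P k σ τ m -> count (same_unordered (σ, τ)) M = 1%N &
          forall i j m1 m2, (i < j < size M)%N ->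
            GT_hops P k (nth ((0,(0,0)),(0,(0,0)))%N M i).1 (nth ((0,(0,0)),(0,(0,0)))%N M i).2 m1 ->
            GT_hops P k (nth ((0,(0,0)),(0,(0,0)))%N M j).1 (nth ((0,(0,0)),(0,(0,0)))%N M j).2 m2 -> (m1 <= m2)%N]
    & merges_run t P lead (flatten [seq G σ | σ <- NL] ++ F) M H].
End FSS.

(* Main.v *)
Require Import Defs.
From HB Require Import structures.
From mathcomp Require Import all_boot all_order all_algebra.
From mathcomp Require Import reals.
From mathcomp Require Import zify ring lra.
(* Every leaf contributes at most k^2 greedy edges and the WSPD spanner is linear
   by hypothesis, so only the edges added by merging matter.  Such an edge {u,v}
   had no t-path when it was added, so it cannot be close, relative to |uv|, to an
   earlier edge {x,y} for which u,x and v,y are already joined by short paths.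
   Greedy spanners join u and x within a leaf; leaders and the t'-spanner join them
   if both lie in leaves of small diameter.  Leaves of large diameter are disjoint
   squares, hence only O(1) of them meet a small box.  So it suffices to show that
   the pairs of P fall into O(n) classes of close pairs.  A farthest-first ordering
   attaches to each point c an insertion radius, and every pair u,v of P has a point
   c at distance O(|uv|) from u and v with insertion radius comparable to |uv|; the
   class of (u,v) is then c together with the cells of u and v in a bounded grid
   around c. *)
Set Implicit Arguments.
Unset Strict Implicit.
Unset Printing Implicit Defensive.
Import Order.TTheory GRing.Theory Num.Theory.
Local Open Scope ring_scope.

Section SpannerSize.
Variable R : realType.
Implicit Types (p q u v a b c : pt R) (E H G : graph R) (P Q S : seq (pt R)).
Implicit Types (t r g : R).

(** * The Euclidean metric *)

Lemma dist_ge0 p q : 0 <= dist p q.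
Proof. exact: sqrtr_ge0. Qed.

Lemma distxx p : dist p p = 0.
Proof. by rewrite /dist !subrr expr0n /= addr0 sqrtr0. Qed.

Lemma dist_sym p q : dist p q = dist q p.
Proof. by rewrite /dist -sqrrN opprB -[X in _ + X]sqrrN opprB. Qed.

Lemma sqr_dist p q : dist p q ^+ 2 = (p.1 - q.1) ^+ 2 + (p.2 - q.2) ^+ 2.
Proof. by rewrite sqr_sqrtr // addr_ge0 ?sqr_ge0. Qed.

Lemma dist_gt0 p q : (0 < dist p q) = (p != q).
Proof.
rewrite lt_def dist_ge0 andbT; congr negb; apply/eqP/eqP => [d0|->]; last exact: distxx.
have /eqP := sqr_dist p q.
rewrite d0 expr0n /= eq_sym paddr_eq0 ?sqr_ge0 // !sqrf_eq0 !subr_eq0.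
by case: p q {d0} => p1 p2 [q1 q2] /= /andP[/eqP-> /eqP->].
Qed.

(** The triangle inequality in difference coordinates, with the lengths known only through their
    squares so that no root appears. *)
Lemma minkowski2 (X Y Z x1 x2 y1 y2 : R) : 0 <= X -> 0 <= Y -> 0 <= Z ->
  X ^+ 2 = (x1 + y1) ^+ 2 + (x2 + y2) ^+ 2 ->
  Y ^+ 2 = x1 ^+ 2 + x2 ^+ 2 -> Z ^+ 2 = y1 ^+ 2 + y2 ^+ 2 -> X <= Y + Z.
Proof.
move=> X0 Y0 Z0 EX EY EZ.
(* Cauchy-Schwarz; after squaring, the slack is [(x1 * y2 - x2 * y1) ^+ 2]. *)
have cs : x1 * y1 + x2 * y2 <= Y * Z.
  have [|pos] := leP (x1 * y1 + x2 * y2) 0.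
    by move=> /le_trans; apply; rewrite mulr_ge0.
  rewrite -(ler_pXn2r (n:=2)) // ?nnegrE ?mulr_ge0 ?(ltW pos) //.
  have -> : (Y * Z) ^+ 2 = Y ^+ 2 * Z ^+ 2 by rewrite exprMn.
  by rewrite EY EZ; have := sqr_ge0 (x1 * y2 - x2 * y1); nra.
have YZ : 0 <= Y + Z by rewrite addr_ge0.
by rewrite leNgt; apply/negP => lt; nra.
Qed.

Lemma dist_triangle q p u : dist p u <= dist p q + dist q u.
Proof.
apply: (minkowski2 (dist_ge0 _ _) (dist_ge0 _ _) (dist_ge0 _ _) _ (sqr_dist p q) (sqr_dist q u)).
by rewrite sqr_dist !addrA !subrK.
Qed.

Lemma ler_coord_dist p q : `|p.1 - q.1| <= dist p q /\ `|p.2 - q.2| <= dist p q.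
Proof.
have := sqr_dist p q; have := dist_ge0 p q => d0 dE.
by split; rewrite -(ler_pXn2r (n:=2)) ?nnegrE // real_normK ?num_real // dE;
  rewrite ?lerDl ?lerDr ?sqr_ge0.
Qed.

Lemma dist_le_coord p q r :
  `|p.1 - q.1| <= r -> `|p.2 - q.2| <= r -> dist p q <= 2 * r.
Proof.
move=> le1 le2; have r0 := le_trans (normr_ge0 _) le1.
rewrite -(ler_pXn2r (n:=2)) ?nnegrE ?dist_ge0 ?mulr_ge0 // sqr_dist.
rewrite -[(p.1 - q.1) ^+ 2]real_normK ?num_real // -[(p.2 - q.2) ^+ 2]real_normK ?num_real //.
by have := normr_ge0 (p.1 - q.1); have := normr_ge0 (p.2 - q.2); nra.
Qed.

(** Makes the counting measures of later inductions decrease: [x] witnesses the strict drop. *)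
Lemma count_ltn (T : eqType) (a1 a2 : pred T) (x : T) (s : seq T) :
  subpred a1 a2 -> x \in s -> a2 x -> ~~ a1 x -> (count a1 s < count a2 s)%N.
Proof.
move=> sub xs a2x a1x.
have := count_predUI a1 (pred1 x) s.
rewrite (eq_count (a1 := predI _ _) (a2 := pred0)); last first.
  by move=> y /=; case: eqVneq => [->|]; rewrite ?andbF ?(negbTE a1x).
have : (0 < count (pred1 x) s)%N by rewrite -has_count has_pred1.
have : (count (predU a1 (pred1 x)) s <= count a2 s)%N.
  by apply: sub_count => y /= /orP[/sub|/eqP->].
by rewrite count_pred0; lia.
Qed.

(** * Short paths *)

Lemma adj_sym E p q : adj E p q = adj E q p.
Proof. by rewrite /adj orbC. Qed.

Lemma sp_le_refl E u (x : R) : 0 <= x -> sp_le E u u x.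
Proof. by move=> x0; exists 0; split=> //; exists [::]. Qed.

Lemma sp_le_weaken E u v (x y : R) : x <= y -> sp_le E u v x -> sp_le E u v y.
Proof. by move=> xy [L [pL Lx]]; exists L; split=> //; apply: le_trans Lx xy. Qed.

Lemma sp_le_sub E H u v (x : R) : {subset E <= H} -> sp_le E u v x -> sp_le H u v x.
Proof.
move=> sEH [L [[w [pw lw wL]] Lx]]; exists L; split=> //; exists w; split=> //.
by apply: sub_path pw => p q /orP[] /sEH pq; apply/orP; [left | right].
Qed.

Lemma sp_le_edge E u v : adj E u v -> sp_le E u v (dist u v).
Proof.
move=> uv; exists (dist u v); split=> //; exists [:: v].
by split; rewrite //= ?uv ?addr0.
Qed.

Lemma walk_len_cat u (w1 w2 : seq (pt R)) :
  walk_len u (w1 ++ w2) = walk_len u w1 + walk_len (last u w1) w2.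
Proof. by elim: w1 u => [|x w IH] u /=; rewrite ?add0r // IH addrA. Qed.

Lemma sp_le_trans E v u q (x y : R) :
  sp_le E u v x -> sp_le E v q y -> sp_le E u q (x + y).
Proof.
move=> [L1 [[w1 [p1 l1 e1]] le1]] [L2 [[w2 [p2 l2 e2]] le2]].
exists (L1 + L2); split; last exact: lerD.
by exists (w1 ++ w2); split; rewrite ?cat_path ?last_cat ?walk_len_cat l1 ?p1 ?e1 ?e2.
Qed.

Lemma sp_le_sym E u v (x : R) : sp_le E u v x -> sp_le E v u x.
Proof.
move=> [L [[w [pw lw wL]] Lx]]; apply: (@sp_le_weaken _ _ _ L) => //.
elim: w u L {Lx x} pw lw wL => [|y w IH] u L /=; first by move=> _ -> <-; exact: sp_le_refl.
case/andP=> uy pw lw <-; rewrite addrC.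
apply: (@sp_le_trans _ y); first exact: IH.
by rewrite dist_sym; apply: sp_le_edge; rewrite adj_sym.
Qed.

(** * Pairs and edge counts *)

Lemma size_pairs_of Q : (size (pairs_of Q) <= size Q * size Q)%N.
Proof.
elim: Q => //= x Q IH; rewrite size_cat size_map mulSn mulnS; lia.
Qed.

Lemma pairs_of_sub Q e : e \in pairs_of Q -> e.1 \in Q /\ e.2 \in Q.
Proof.
elim: Q => //= x Q IH; rewrite mem_cat => /orP[/mapP[y yQ ->]|/IH[e1 e2]] /=.
  by rewrite !inE eqxx yQ orbT.
by rewrite !inE e1 e2 !orbT.
Qed.

Lemma pairs_of_neq Q e : uniq Q -> e \in pairs_of Q -> e.1 != e.2.
Proof.
elim: Q => //= x Q IH /andP[xQ uQ]; rewrite mem_cat => /orP[/mapP[y yQ ->]|/IH->//] /=.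
by apply: contraNneq xQ => ->.
Qed.

Lemma pairs_of_total Q p q : p \in Q -> q \in Q -> p != q ->
  ((p, q) \in pairs_of Q) || ((q, p) \in pairs_of Q).
Proof.
elim: Q => //= x Q IH; rewrite !inE !mem_cat.
case: (eqVneq p x) => [->|px] /= pQ; case: (eqVneq q x) => [->|qx] /= qQ pq.
- by [].
- by rewrite map_f.
- by rewrite map_f ?orbT.
- by case/orP: (IH pQ qQ pq) => ->; rewrite !orbT.
Qed.

Lemma uniq_pairs_of Q : uniq Q -> uniq (pairs_of Q).
Proof.
elim: Q => //= x Q IH /andP[xQ uQ].
rewrite cat_uniq IH // andbT map_inj_uniq ?uQ /=; last by move=> y z [].
apply/hasPn => e /pairs_of_sub[e1 _]; apply: contra xQ => /mapP[y yQ Ee].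
by rewrite Ee /= in e1.
Qed.

Lemma pairs_of_asym Q p q : uniq Q -> (p, q) \in pairs_of Q -> (q, p) \notin pairs_of Q.
Proof.
elim: Q => //= x Q IH /andP[xQ uQ]; rewrite !mem_cat => /orP[/mapP[y yQ [-> ->]]|pq].
  rewrite negb_or; apply/andP; split.
    by apply/mapP => -[z _ [yx _]]; rewrite -yx yQ in xQ.
  by apply: contra xQ => /pairs_of_sub[].
rewrite negb_or IH // andbT; apply: contra xQ => /mapP[z zQ [<- _]].
by have [] := pairs_of_sub pq.
Qed.

Lemma num_edges_le P E : uniq P -> (num_edges P E <= size E)%N.
Proof.
move=> uP; rewrite /num_edges -size_filter.
(* [adj] ignores orientation while [pairs_of P] lists each pair once, so [f] turns a stored edge to
   its listed orientation; every counted pair is an image under [f]. *)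
pose f (e : pt R * pt R) := if e \in pairs_of P then e else (e.2, e.1).
rewrite -(size_map f E); apply: uniq_leq_size; first exact/filter_uniq/uniq_pairs_of.
move=> -[p q]; rewrite mem_filter /= => /andP[/orP[pqE|qpE] pq]; apply/mapP.
  by exists (p, q) => //; rewrite /f pq.
by exists (q, p) => //; rewrite /f (negbTE (pairs_of_asym uP pq)).
Qed.

(** * Greedy spanners *)

Lemma greedy_run_sub t E (L : seq (pt R * pt R)) E' : greedy_run t E L E' ->
  [/\ {subset E <= E'}, {subset E' <= L ++ E} & (size E' <= size L + size E)%N].
Proof.
elim=> {E L E'} [E|E p q L E' _ _ [s1 s2 sz]|E p q L E' _ _ [s1 s2 sz]]; first by split.
  split=> //=; last by lia.
  by move=> e /s2; rewrite inE => ->; rewrite orbT.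
split=> /=; last by move: sz => /=; lia.
  by move=> e eE; apply: s1; rewrite inE eE orbT.
by move=> e /s2; rewrite !(mem_cat, inE) orbCA.
Qed.

(** A pair has a short path when skipped and is an edge when added; later steps only enlarge the
    graph. *)
Lemma greedy_run_spans t E (L : seq (pt R * pt R)) E' : 1 <= t -> greedy_run t E L E' ->
  forall p q, (p, q) \in L -> sp_le E' p q (t * dist p q).
Proof.
move=> t1; elim=> {E L E'} [//|E p q L E' pq run IH|E p q L E' _ run IH] x y;
  rewrite inE => /orP[/eqP[-> ->]|/IH//]; have [s1 _ _] := greedy_run_sub run.
  exact: sp_le_sub s1 pq.
apply: (@sp_le_weaken _ _ _ (dist p q)); first by rewrite ler_peMl ?dist_ge0.
by apply: (sp_le_sub s1); apply: sp_le_edge; rewrite /adj inE eqxx.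
Qed.

Lemma fg_greedy_sub Q t G : fg_greedy Q t G ->
  {subset G <= pairs_of Q} /\ (size G <= size Q * size Q)%N.
Proof.
move=> [L [pL _ run]]; have [_ s2 sz] := greedy_run_sub run; split.
  by move=> e /s2; rewrite cats0 (perm_mem pL).
by rewrite (leq_trans _ (size_pairs_of Q)) // -(perm_size pL) -[size L]addn0.
Qed.

Lemma fg_greedy_spans Q t G p q : 1 <= t -> fg_greedy Q t G ->
  p \in Q -> q \in Q -> sp_le G p q (t * dist p q).
Proof.
move=> t1 [L [pL _ run]] pQ qQ; have [->|pq] := eqVneq p q.
  by apply: sp_le_refl; rewrite mulr_ge0 ?dist_ge0 // (le_trans _ t1).
case/orP: (pairs_of_total pQ qQ pq); rewrite -(perm_mem pL) => /(greedy_run_spans t1 run)//.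
by rewrite dist_sym; exact: sp_le_sym.
Qed.

(** * Cells of the quad-tree *)

Lemma coord_min_le P (f : pt R -> R) p : p \in P -> coord_min P f <= f p.
Proof.
rewrite /coord_min; move: (f (head _ _)) => z; elim: P => //= q P IH.
rewrite inE => /orP[/eqP->|pP]; first by rewrite ge_min lexx.
by rewrite ge_min IH ?orbT.
Qed.

Lemma coord_max_ge P (f : pt R -> R) p : p \in P -> f p <= coord_max P f.
Proof.
rewrite /coord_max; move: (f (head _ _)) => z; elim: P => //= q P IH.
rewrite inE => /orP[/eqP->|pP]; first by rewrite le_max lexx.
by rewrite le_max IH ?orbT.
Qed.

Lemma root_side_ge0 P : 0 <= root_side P.
Proof.
case: P => [|p P]; first by rewrite /root_side /coord_max /coord_min /= !subrr maxxx.
have pP : p \in p :: P by rewrite mem_head.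
rewrite /root_side le_max subr_ge0.
by rewrite (le_trans (coord_min_le fst pP)) ?coord_max_ge.
Qed.

Lemma in_root_square P p : p \in P ->
  (root_x P <= p.1 <= root_x P + root_side P) &&
  (root_y P <= p.2 <= root_y P + root_side P).
Proof.
move=> pP; rewrite /root_x /root_y !coord_min_le //=; apply/andP; split.
  by rewrite -lerBlDl /root_side le_max lerD2r coord_max_ge.
by rewrite -lerBlDl /root_side le_max lerD2r coord_max_ge ?orbT.
Qed.

(** Truncation at a fine resolution determines truncation at a coarser one; this is what nests the
    cells. *)
Lemma truncn_mulr_divn (y : R) (n : nat) : (0 < n)%N ->
  (Num.truncn (y * n%:R) %/ n)%N = Num.truncn y.
Proof.
move=> n0; have n0' : 0 < n%:R :> R by rewrite ltr0n.
have [y0|y0] := leP 0 y; last first.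
  have /truncn0Pn -> : ~~ (1 <= y) by rewrite -ltNge (lt_trans y0).
  have /truncn0Pn -> : ~~ (1 <= y * n%:R).
    by rewrite -ltNge (lt_trans _ ltr01) // pmulr_llt0.
  by rewrite div0n.
have /andP[l u] := truncn_itv y0.
apply/eqP; rewrite eqn_leq -ltnS ltn_divLR // leq_divRL //.
rewrite truncn_lt_nat ?truncn_ge_nat ?mulr_ge0 ?(ltW n0') // !natrM.
by rewrite ltr_pM2r // u ler_pM2r.
Qed.

Lemma cell_index_div P (a0 x : R) (d d' : nat) : (d <= d')%N ->
  (cell_index P a0 x d' %/ 2 ^ (d' - d))%N = cell_index P a0 x d.
Proof.
move=> dd'; rewrite /cell_index; case: eqP => _; first by rewrite div0n.
have e0 m : (0 < 2 ^ m)%N by rewrite expn_gt0.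
have Ed : (2 ^ d' = 2 ^ d * 2 ^ (d' - d))%N by rewrite -expnD subnKC.
have mono : {homo divn^~ (2 ^ (d' - d))%N : m n / (m <= n)%N >-> (m <= n)%N}.
  by move=> m n mn; apply: leq_div2r.
have minE m n : (minn m n %/ 2 ^ (d' - d) = minn (m %/ 2 ^ (d' - d)) (n %/ 2 ^ (d' - d)))%N.
  have [mn|/ltnW nm] := leqP m n.
    by rewrite (minn_idPl _) // leq_div2r.
  by rewrite (minn_idPr _) // leq_div2r.
rewrite minE; congr minn.
  by rewrite Ed natrM mulrA truncn_mulr_divn.
(* The caps are compatible too: [2 ^ d' - 1] divided by [2 ^ (d' - d)] is [2 ^ d - 1]. *)
apply/eqP; rewrite eqn_leq -ltnS prednK // ltn_divLR // leq_divRL // -Ed.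
rewrite prednK // leqnn /= Ed; have := e0 (d' - d)%N; have := e0 d.
set A := (2 ^ d)%N; set B := (2 ^ _)%N => A0 B0.
by rewrite -(prednK A0) /= mulSn -(prednK B0) addSn /= leq_addl.
Qed.

Lemma cell_index_mono P (a0 x y : R) (d : nat) : x <= y ->
  (cell_index P a0 x d <= cell_index P a0 y d)%N.
Proof.
move=> xy; rewrite /cell_index; case: eqP => // _.
rewrite leq_min geq_minr andbT (leq_trans (geq_minl _ _)) //.
apply: le_truncn; rewrite ler_wpM2r // ler_wpM2r ?invr_ge0 ?root_side_ge0 //.
by rewrite lerD2r.
Qed.

Lemma cell_index_step P (a0 x : R) (d : nat) :
  (cell_index P a0 (x + root_side P / (2 ^ d)%N%:R) d <= (cell_index P a0 x d).+1)%N.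
Proof.
rewrite /cell_index; case: eqP => // /eqP s0; set e := (2 ^ d)%N.
have e0 : (e%:R : R) != 0 by rewrite pnatr_eq0 -lt0n expn_gt0.
have -> : (x + root_side P / e%:R - a0) / root_side P * e%:R =
    (x - a0) / root_side P * e%:R + 1 by field; rewrite s0.
set z := _ * e%:R.
have le : (Num.truncn (z + 1)%R <= (Num.truncn z).+1)%N.
  by rewrite truncn_le_nat -natr1 ltrD2r truncnS_gt.
by rewrite /minn; do 2!case: ifP; lia.
Qed.

Lemma cell_index_width P (a0 x y : R) (d : nat) :
  a0 <= x <= a0 + root_side P -> a0 <= y <= a0 + root_side P ->
  cell_index P a0 x d = cell_index P a0 y d ->
  `|x - y| <= root_side P / (2 ^ d)%N%:R.
Proof.
move=> xI yI; have := root_side_ge0 P; rewrite le_eqVlt => /orP[/eqP s0|s0].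
  rewrite -s0 addr0 in xI yI; rewrite -s0 mul0r.
  by rewrite -(le_anti xI) -(le_anti yI) subrr normr0.
rewrite /cell_index (gt_eqF s0); set e := (2 ^ d)%N; set s := root_side P in s0 xI yI *.
have e0 : (0 < e)%N by rewrite expn_gt0.
have e0' : 0 < e%:R :> R by rewrite ltr0n.
(* The upper bound is not strict: the far border has scaled coordinate [2 ^ d], which the cap
   assigns to the last cell. *)
have bnd z : a0 <= z <= a0 + s ->
  (minn (Num.truncn ((z - a0) / s * e%:R)) e.-1)%:R <= (z - a0) / s * e%:R
    <= (minn (Num.truncn ((z - a0) / s * e%:R)) e.-1)%:R + 1.
  move=> /andP[z0 z1]; set w := _ * e%:R.
  have w0 : 0 <= w by rewrite !mulr_ge0 ?subr_ge0 // invr_ge0 ltW.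
  have w1 : w <= e%:R by rewrite ler_piMl ?(ltW e0') // ler_pdivrMr // mul1r lerBlDl.
  have /andP[lw uw] := truncn_itv w0.
  have [le|lt] := leqP (Num.truncn w) e.-1; first by rewrite lw natr1 ltW.
  rewrite natr1 (prednK e0) w1 andbT (le_trans _ lw) // ler_nat ltnW //.
move=> ixy; have := bnd x xI; have := bnd y yI; rewrite /= ixy.
set i := minn _ _ => /andP[ly uy] /andP[lx ux].
have -> : x - y = ((x - a0) / s * e%:R - (y - a0) / s * e%:R) * (s / e%:R).
  by field; rewrite !gt_eqF.
have se : 0 < s / e%:R by rewrite divr_gt0.
rewrite normrM (gtr0_norm se) -[leRHS]mul1r ler_pM2r // ler_norml; apply/andP; lra.
Qed.

(** At different depths the shallower leaf would be a proper ancestor of the deeper one and hold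
    more than [k] points. The point [z] need not lie in [P]: it will also be a grid corner. *)
Lemma leaf_disjoint P (k : nat) (σ τ : node) z :
  is_leaf P k σ -> is_leaf P k τ -> in_node P σ z -> in_node P τ z -> σ = τ.
Proof.
wlog dd : σ τ / (σ.1 <= τ.1)%N.
  move=> wl; have [|/ltnW] := leqP σ.1 τ.1; first exact: wl.
  by move=> /wl H A B C D; apply/esym/H.
case: σ τ dd => [d [i j]] [d' [i' j']] /= dd; rewrite /is_leaf /is_tree_node /=.
move=> /andP[_ small] /andP[/and3P[_ _ /allP big] _].
rewrite /in_node /= => /andP[/eqP xi /eqP yj] /andP[/eqP xi' /eqP yj'].
move: dd; rewrite leq_eqVlt => /orP[/eqP dE|lt].
  by rewrite -xi -yj -xi' -yj' dE.
have := big d; rewrite mem_iota lt => /(_ isT); rewrite /ancestor /= -xi' -yj'.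
by rewrite !cell_index_div ?(ltnW lt) // xi yj ltnNge small.
Qed.

Definition node_width P (σ : node) : R := root_side P / (2 ^ σ.1)%N%:R.

Lemma node_pts_dist P (σ : node) p q :
  p \in node_pts P σ -> q \in node_pts P σ -> dist p q <= 2 * node_width P σ.
Proof.
rewrite !mem_filter => /andP[/andP[/eqP p1 /eqP p2] pP] /andP[/andP[/eqP q1 /eqP q2] qP].
have /andP[px py] := in_root_square pP; have /andP[qx qy] := in_root_square qP.
apply: dist_le_coord; first exact: cell_index_width px qx (etrans p1 (esym q1)).
exact: cell_index_width py qy (etrans p2 (esym q2)).
Qed.

(** An interval no longer than a cell meets at most two cells, so each of its points shares a cell
    with an endpoint. *)
Lemma cell_index_endpoint P (a0 x y g : R) (d : nat) :
  g <= root_side P / (2 ^ d)%N%:R -> x <= y <= x + g ->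
  exists b : bool, cell_index P a0 (x + b%:R * g) d = cell_index P a0 y d.
Proof.
move=> gw /andP[xy yx].
have := cell_index_mono P a0 d xy; rewrite leq_eqVlt => /orP[/eqP|lt].
  by exists false; rewrite mul0r addr0.
exists true; rewrite mul1r; apply/eqP; rewrite eqn_leq (cell_index_mono _ _ _ yx) andbT.
apply: leq_trans lt; apply: leq_trans (cell_index_step P a0 x d).
by rewrite cell_index_mono // lerD2l.
Qed.

(* A square at least as wide as an axis-parallel box it meets contains a corner
   of that box. *)
Lemma in_node_corner P (σ : node) p g c :
  g <= node_width P σ -> in_node P σ p ->
  c.1 <= p.1 <= c.1 + g -> c.2 <= p.2 <= c.2 + g ->
  exists b1 b2 : bool, in_node P σ (c.1 + b1%:R * g, c.2 + b2%:R * g).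
Proof.
move=> gw /andP[/eqP i1 /eqP i2] c1 c2.
have [b1 e1] := cell_index_endpoint (root_x P) gw c1.
have [b2 e2] := cell_index_endpoint (root_y P) gw c2.
by exists b1, b2; rewrite /in_node /= e1 e2 i1 i2 !eqxx.
Qed.

(** * Nested nets *)

Lemma coord_min_attained P (f : pt R -> R) : P != [::] ->
  exists2 p, p \in P & f p = coord_min P f.
Proof.
case: P => // p0 P _; rewrite /coord_min /head.
suff [->|[p pP <-]] : foldr Num.min (f p0) (map f (p0 :: P)) = f p0 \/
    exists2 p, p \in p0 :: P & f p = foldr Num.min (f p0) (map f (p0 :: P)).
- by exists p0; rewrite ?mem_head.
- by exists p.
elim: (p0 :: P) => [|q Q IH] /=; first by left.
rewrite minEle; case: ifP => _; first by right; exists q; rewrite ?mem_head.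
case: IH => [->|[p pQ <-]]; first by left.
by right; exists p; rewrite // inE pQ orbT.
Qed.

Lemma coord_max_attained P (f : pt R -> R) : P != [::] ->
  exists2 p, p \in P & f p = coord_max P f.
Proof.
case: P => // p0 P _; rewrite /coord_max /head.
suff [->|[p pP <-]] : foldr Num.max (f p0) (map f (p0 :: P)) = f p0 \/
    exists2 p, p \in p0 :: P & f p = foldr Num.max (f p0) (map f (p0 :: P)).
- by exists p0; rewrite ?mem_head.
- by exists p.
elim: (p0 :: P) => [|q Q IH] /=; first by left.
rewrite maxEle; case: ifP => _; last by right; exists q; rewrite ?mem_head.
case: IH => [->|[p pQ <-]]; first by left.
by right; exists p; rewrite // inE pQ orbT.
Qed.

(* [rad x] is the scale down to which [x] belongs to the nets: for every
   [tau <= D] the points with [tau <= rad x] are [tau]-dense in [P]. *)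
Definition net_radii P (D : R) (rad : pt R -> R) : Prop :=
  (forall tau u, 0 <= tau <= D -> u \in P ->
     exists2 x, x \in P & tau <= rad x /\ dist u x <= tau) /\
  (forall x y, x \in P -> y \in P -> x != y -> Num.min (rad x) (rad y) <= dist x y).

(* Farthest-first insertion: [N] is the current net, [rho] its covering radius. *)
Lemma net_radii_extend P (D : R) (N : seq (pt R)) (rho : R) (rad : pt R -> R) :
  N != [::] -> {subset N <= P} -> 0 <= rho ->
  (forall x, x \in N -> rho <= rad x) ->
  (forall x y, x \in N -> y \in N -> x != y -> Num.min (rad x) (rad y) <= dist x y) ->
  (forall tau u, rho <= tau <= D -> u \in P ->
     exists2 x, x \in N & tau <= rad x /\ dist u x <= tau) ->
  (forall u, u \in P -> exists2 x, x \in N & dist u x <= rho) ->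
  exists rad', net_radii P D rad'.
Proof.
(* Induction on the number of points of [P] outside the net. *)
move mE : (count (fun p => p \notin N) P) => m.
elim/ltn_ind: m N rho rad mE => m IH N rho rad mE N0 NP rho0 radN sepN netN covN.
have [/hasP[p1 p1P p1N]|/hasPn PN] := boolP (has (fun p => p \notin N) P); last first.
  exists rad; split=> [tau u /andP[tau0 tauD] uP|x y /PN + /PN]; last first.
    by rewrite !negbK; apply: sepN.
  (* Here the net is all of [P], so [u] itself serves every scale below [rho]. *)
  have [le|lt] := leP rho tau.
    have [|x xN xP] := netN tau u _ uP; first by rewrite le.
    by exists x; rewrite ?NP.
  exists u; rewrite // distxx; split=> //.
  by rewrite (le_trans (ltW lt)) // radN //; move/PN: uP; rewrite negbK.
(* [gap] is the distance to the net. The point [p] maximizing it joins next, with radius [gap p],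
   which is also the new covering radius. *)
pose gap u := coord_min N (dist u).
have gapN u x : x \in N -> gap u <= dist u x by apply: coord_min_le.
have [|p pP pmax] := @coord_max_attained P gap; first by apply: contraTneq p1P => ->.
have gap_le u : u \in P -> gap u <= gap p by move=> uP; rewrite pmax coord_max_ge.
have gap0 : 0 < gap p.
  rewrite (lt_le_trans _ (gap_le _ p1P)) // /gap.
  have [x xN <-] := coord_min_attained (dist p1) N0.
  by rewrite dist_gt0; apply: contraNneq p1N => ->.
have gaprho : gap p <= rho.
  by have [x xN le] := covN p pP; apply: le_trans (gapN _ _ xN) le.
have pN : p \notin N.
  by apply/negP => /(gapN p); rewrite distxx leNgt gap0.
have radE x : x \in N -> (if x == p then gap p else rad x) = rad x.
  by move=> xN; case: eqP => // xp; rewrite xp (negbTE pN) in xN.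
have covN' u : u \in P -> exists2 x, x \in N & dist u x <= gap p.
  move=> uP; have [x xN xE] := coord_min_attained (dist u) N0.
  by exists x; rewrite // xE gap_le.
have mlt : (count (fun q => q \notin p :: N) P < m)%N.
  rewrite -mE; apply: (@count_ltn _ _ _ p); rewrite //= ?inE ?eqxx //.
  by move=> q /=; rewrite inE negb_or => /andP[].
apply: (IH _ mlt (p :: N) (gap p) (fun x => if x == p then gap p else rad x)) => //.
- by move=> x; rewrite inE => /orP[/eqP->|/NP].
- exact: ltW.
- move=> x; rewrite inE; case: eqP => //= _ xN.
  by rewrite (le_trans gaprho) ?radN.
- move=> x y; rewrite !inE; case: (eqVneq x p) => [->|xp] /=; case: (eqVneq y p) => [->|yp] //=.
  + by move=> _ yN _; rewrite ge_min gapN.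
  + by move=> xN _ _; rewrite ge_min dist_sym gapN ?orbT.
  + exact: sepN.
(* Scales from [rho] up keep their witness; those between [gap p] and [rho] are served by the old
   net, which covers [P] at distance [gap p]. *)
- move=> tau u /andP[tau1 tauD] uP; have [le|lt] := leP rho tau.
    have [|x xN [xr xu]] := netN tau u _ uP; first by rewrite le.
    by exists x; rewrite ?inE ?xN ?orbT // radE.
  have [x xN xu] := covN' u uP; exists x; first by rewrite inE xN orbT.
  by rewrite radE // (le_trans (ltW lt)) ?radN // (le_trans xu).
- by move=> u /covN'[x xN xu]; exists x; rewrite // inE xN orbT.
Qed.

Lemma dist_le_root_side P p q : p \in P -> q \in P -> dist p q <= 2 * root_side P.
Proof.
move=> /in_root_square/andP[/andP[? ?] /andP[? ?]] /in_root_square/andP[/andP[? ?] /andP[? ?]].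
by apply: dist_le_coord; rewrite ler_norml; apply/andP; lra.
Qed.

Lemma ex_net_radii P : exists rad, net_radii P (2 * root_side P) rad.
Proof.
have D0 : 0 <= 2 * root_side P by rewrite mulr_ge0 ?root_side_ge0.
case PE : P => [|p0 P']; first by exists (fun=> 0); split.
rewrite -PE; have p0P : p0 \in P by rewrite PE mem_head.
(* One point covers [P] at twice the root side, which bounds all distances in [P]. *)
apply: (@net_radii_extend P _ [:: p0] (2 * root_side P) (fun=> 2 * root_side P)) => //.
- by move=> x; rewrite inE => /eqP->.
- by move=> x y; rewrite !inE => /eqP-> /eqP->; rewrite eqxx.
- move=> tau u /andP[t1 t2] uP; exists p0; rewrite ?mem_head //; split=> //.
  by rewrite (le_trans _ t1) ?dist_le_root_side.
- by move=> u uP; exists p0; rewrite ?mem_head ?dist_le_root_side.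
Qed.

(** At scale [dist u v / 4], net points [x] near [u] and [y] near [v] are distinct and at most
    [3/2 * dist u v] apart. Separation bounds one of their radii by [dist x y]; that point is
    [c]. *)
Lemma ex_pair_scale P : exists rad : pt R -> R, forall u v, u \in P -> v \in P -> u != v ->
  exists2 c, c \in P & [/\ dist u v <= 4 * rad c, rad c <= 2 * dist u v,
    dist u c <= 2 * dist u v & dist v c <= 2 * dist u v].
Proof.
have [rad [net sep]] := ex_net_radii P; exists rad => u v uP vP uv.
have L0 : 0 < dist u v by rewrite dist_gt0.
have tauI : 0 <= dist u v / 4 <= 2 * root_side P.
  by have := dist_le_root_side uP vP => le; apply/andP; lra.
have [x xP [xr xu]] := net _ u tauI uP; have [y yP [yr yv]] := net _ v tauI vP.
have xv := dist_triangle u x v; have uvx := dist_triangle x u v.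
have xyv := dist_triangle y x v; have yu := dist_triangle v y u.
have xuy := dist_triangle u x y; have uvy := dist_triangle v u y.
rewrite (dist_sym x u) in xv xuy; rewrite (dist_sym y v) in xyv yu.
rewrite (dist_sym v u) in yu.
have xy : x != y by rewrite -dist_gt0; lra.
have := sep x y xP yP xy; rewrite ge_min => /orP[rx|ry].
  by exists x => //; rewrite (dist_sym v x); split; lra.
by exists y => //; rewrite (dist_sym u y); split; lra.
Qed.

(** * WSPD spanners *)

Lemma well_separated_dist (s : R) (A B : seq (pt R)) p q a b : well_separated s A B ->
  p \in A -> a \in A -> q \in B -> b \in B ->
  exists r, [/\ 0 <= r, dist p a <= 2 * r, dist b q <= 2 * r,
    s * r <= dist p q & 0 < dist a b].
Proof.
move=> [c1 [c2 [r [r0 /allP rA /allP rB disj sep]]]] pA aA qB bB.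
exists r; have := rA _ pA; have := rA _ aA; have := rB _ qB; have := rB _ bB.
have := dist_triangle c1 p a; have := dist_triangle c2 b q.
have := dist_triangle p c1 c2; have := dist_triangle q p c2.
have := dist_triangle a c1 c2; have := dist_triangle b a c2.
rewrite (dist_sym c1 p) (dist_sym c1 a) (dist_sym c2 q) => *.
by split=> //; lra.
Qed.

Lemma all2_edge (W : seq (seq (pt R) * seq (pt R))) (F : graph R) AB :
  all2 (fun AB e => (e.1 \in AB.1) && (e.2 \in AB.2)) W F -> AB \in W ->
  exists2 e, e \in F & e.1 \in AB.1 /\ e.2 \in AB.2.
Proof.
elim: W F => [|AB' W IH] [|e F] //= /andP[/andP[e1 e2] /IH WF].
rewrite inE => /orP[/eqP->|/WF[f fF fAB]]; first by exists e; rewrite ?mem_head.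
by exists f; rewrite // inE fF orbT.
Qed.

Lemma all2_edge_inv (W : seq (seq (pt R) * seq (pt R))) (F : graph R) e :
  all2 (fun AB e => (e.1 \in AB.1) && (e.2 \in AB.2)) W F -> e \in F ->
  exists2 AB, AB \in W & e.1 \in AB.1 /\ e.2 \in AB.2.
Proof.
elim: W F => [|AB W IH] [|e' F] //= /andP[/andP[e1 e2] /IH WF].
rewrite inE => /orP[/eqP->|/WF[AB' AB'W eAB]]; first by exists AB; rewrite ?mem_head.
by exists AB'; rewrite // inE AB'W orbT.
Qed.

Lemma wspd_spanner_edge t' S W (F : graph R) e : wspd_spanner t' S W F -> e \in F ->
  [/\ e.1 \in S, e.2 \in S & e.1 != e.2].
Proof.
move=> [[Wsep _] WF] /(all2_edge_inv WF)[AB /Wsep[_ _ A1 B1 sep] [e1 e2]].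
split; [exact: A1 | exact: B1 | rewrite -dist_gt0].
by have [r []] := well_separated_dist sep e1 e1 e2 e2.
Qed.

(** The pair separating [p] and [q] contributes an edge [e]; its ends are closer to [p] and to [q],
    respectively, than [p] is to [q], so induction supplies the two outer paths. *)
Lemma wspd_spanner_spans t' S W (F : graph R) p q : 1 < t' -> wspd_spanner t' S W F ->
  p \in S -> q \in S -> sp_le F p q (t' * dist p q).
Proof.
move=> t1 [[Wsep Wcov] WF].
pose pairsS := [seq (x, y) | x <- S, y <- S].
(* Distances are real, so the induction runs on the number of ordered pairs of [S] at smaller
   distance. *)
pose rank (x : R) := count (fun e : pt R * pt R => dist e.1 e.2 < x) pairsS.
have rank_lt x y z : x \in S -> y \in S -> dist x y < z -> (rank (dist x y) < rank z)%N.
  move=> xS yS lt; apply: (@count_ltn _ _ _ (x, y)); rewrite /= ?ltxx //.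
    by move=> e /= /lt_trans; apply.
  exact: allpairs_f.
move mE : (rank (dist p q)) => m; elim/ltn_ind: m p q mE => m IH p q mE pS qS.
have [->|pq] := eqVneq p q; first by apply: sp_le_refl; rewrite distxx mulr0.
have L0 : 0 < dist p q by rewrite dist_gt0.
have: has (separates p q) W by rewrite has_count Wcov.
case/hasP=> AB ABW; have [_ _ AS BS sep] := Wsep _ ABW.
have [e eF [eA eB]] := all2_edge WF ABW.
wlog pq_AB : p q pq L0 pS qS mE / (p \in AB.1) && (q \in AB.2).
  move=> wl sepAB; case/orP: (sepAB) => pqAB; first exact: wl.
  rewrite dist_sym; apply: sp_le_sym; apply: wl; rewrite // 1?eq_sym 1?dist_sym //.
  by rewrite /separates pqAB.
move=> _; case/andP: pq_AB => pA qB.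
have [r [r0 pe eq spq _]] := well_separated_dist sep pA eA qB eB.
(* The separation ratio is chosen for this bound: the three-part path has length at most
   [dist p q + 4 * (t' + 1) * r]. *)
have sr : 4 * (t' + 1) * r <= (t' - 1) * dist p q.
  have t0 : 0 < t' - 1 by rewrite subr_gt0.
  by move: spq; rewrite mulrAC ler_pdivrMr // [leRHS]mulrC.
have r_lt : 2 * r < dist p q by nra.
have path1 : sp_le F p e.1 (t' * dist p e.1).
  apply: (IH (rank (dist p e.1))); rewrite ?AS // -mE rank_lt ?AS //.
  exact: le_lt_trans pe r_lt.
have path2 : sp_le F e.2 q (t' * dist e.2 q).
  apply: (IH (rank (dist e.2 q))); rewrite ?BS // -mE rank_lt ?BS //.
  exact: le_lt_trans eq r_lt.
have path12 : sp_le F e.1 e.2 (dist e.1 e.2).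
  by apply: sp_le_edge; rewrite /adj -surjective_pairing eF.
apply: sp_le_weaken (sp_le_trans path1 (sp_le_trans path12 path2)).
have := dist_triangle p e.1 e.2; have := dist_triangle q p e.2.
rewrite (dist_sym e.1 p) (dist_sym q e.2) => h1 h2.
by nra.
Qed.

(** * Merging *)

(** Edges are listed newest first: [E' ++ E0] is the graph to which [e] was added. *)
Fixpoint irredundant t (E0 E : graph R) : Prop :=
  if E is e :: E' then
    ~ sp_le (E' ++ E0) e.1 e.2 (t * dist e.1 e.2) /\ irredundant t E0 E'
  else True.

Lemma irredundant_cat t (E0 E1 E2 : graph R) :
  irredundant t E0 E1 -> irredundant t (E1 ++ E0) E2 -> irredundant t E0 (E2 ++ E1).
Proof.
move=> i1; elim: E2 => //= e E2 IH [ni i2].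
by split; [rewrite -catA | exact: IH].
Qed.

(** Only [MR_edge] enlarges the graph, and its guard says that no [t]-path exists at that moment. *)
Lemma merge_run_irredundant t H B (L : seq (pt R * pt R)) H' : merge_run t H B L H' ->
  exists E, [/\ H' = E ++ H, {subset E <= L} & irredundant t H E].
Proof.
elim=> {H B L H'} [H B|H B u v L H' _ _ [E [-> EL iE]]|H B u v L Lp H' _ _ _ _ [E [-> EL iE]]
    |H B u v L H' _ nsp _ [E [-> EL iE]]].
- by exists [::].
- by exists E; split=> // e /EL; rewrite inE => ->; rewrite orbT.
- by exists E; split=> // e /EL; rewrite inE => ->; rewrite orbT.
(* [(u, v)] is the oldest of the new edges, hence last in the list. *)
exists (rcons E (u, v)); split; first by rewrite cat_rcons.
  by move=> e; rewrite mem_rcons !inE => /orP[->//|/EL ->]; rewrite orbT.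
by rewrite -cats1; apply: irredundant_cat.
Qed.

Lemma merges_run_irredundant t P (lead : node -> pt R) H (M : seq (node * node)) H' :
  merges_run t P lead H M H' ->
  exists E, [/\ H' = E ++ H, irredundant t H E &
    forall e, e \in E -> exists2 στ, στ \in M &
      e.1 \in node_pts P στ.1 /\ e.2 \in node_pts P στ.2].
Proof.
elim=> {H M H'} [H|H H1 H' σ τ M [B0 [L [_ pL run]]] _ [E2 [-> i2 E2M]]]; first by exists [::].
have [E1 [H1E E1L i1]] := merge_run_irredundant run.
exists (E2 ++ E1); split; first by rewrite H1E catA.
  by apply: irredundant_cat; rewrite -?H1E.
move=> e; rewrite mem_cat => /orP[/E2M[στ στM eστ]|/E1L].
  by exists στ; rewrite // inE στM orbT.
rewrite (perm_mem pL) => /allpairsP[[u v] [uσ vτ ->]].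
by exists (σ, τ); rewrite ?mem_head.
Qed.

(* A later edge may not share its label with an earlier one, so labels are distinct. *)
Lemma irredundant_labels t (E0 E : graph R) (K : eqType) (label : pt R * pt R -> K -> Prop) :
  (forall e, e \in E -> exists k, label e k) ->
  (forall e e' H k, e \in E -> e' \in E -> label e k -> label e' k ->
     e \in H -> {subset E0 <= H} -> sp_le H e'.1 e'.2 (t * dist e'.1 e'.2)) ->
  irredundant t E0 E ->
  exists ks : seq K, [/\ uniq ks, size ks = size E &
    forall k, k \in ks -> exists2 e, e \in E & label e k].
Proof.
elim: E => [|e E IH] lab close /=; first by exists [::].
have inE' f : f \in E -> f \in e :: E by rewrite inE orbC => ->.
case=> nsp /IH[f /inE'/lab //|f f' H k /inE' fE /inE' f'E|ks [uks sks labks]].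
  exact: close.
have [k ek] := lab e (mem_head _ _); exists (k :: ks); split=> /=; last 2 first.
- by rewrite sks.
- move=> k'; rewrite inE => /orP[/eqP->|/labks[f fE fk]]; first by exists e; rewrite ?mem_head.
  by exists f; rewrite ?inE'.
(* The graph preceding [e] contains [f]; a common label would give [e] a [t]-path there. *)
rewrite uks andbT; apply/negP => /labks[f fE fk]; apply: nsp.
apply: (close f e _ k (inE' _ fE) (mem_head _ _) fk ek); first by rewrite mem_cat fE.
by move=> g gE; rewrite mem_cat gE orbT.
Qed.

(** * Counting the edges added by merging *)

Section Run.
Variables (t t' : R) (k : nat) (P : seq (pt R)) (NL : seq node) (lead : node -> pt R).
Variables (Gr : node -> graph R) (W : seq (seq (pt R) * seq (pt R))) (F : graph R).
Hypotheses (t_gt1 : 1 < t) (le_tt' : t <= t').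
Hypothesis NL_leaf : forall σ : node, σ \in NL -> is_leaf P k σ.
Hypothesis NL_greedy : forall σ : node, σ \in NL ->
  fg_greedy (node_pts P σ) t (Gr σ) /\ is_leader (node_pts P σ) (lead σ).
Hypothesis F_spanner : wspd_spanner t' (undup [seq lead σ | σ <- NL]) W F.

Let E0 : graph R := flatten [seq Gr σ | σ <- NL] ++ F.

Lemma leaf_spans σ u v : σ \in NL -> u \in node_pts P σ -> v \in node_pts P σ ->
  sp_le E0 u v (t * dist u v).
Proof.
move=> σNL uσ vσ; have [grd _] := NL_greedy σNL.
apply: sp_le_sub (fg_greedy_spans (ltW t_gt1) grd uσ vσ) => e eG.
by rewrite mem_cat; apply/orP; left; apply/flatten_mapP; exists σ.
Qed.

(** Route through the two leaders: the parts span distances of at most [2 * g], [6 * g] and [2 * g],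
    each stretched by at most [t']. *)
Lemma small_leaves_span (σ τ : node) u v g :
  σ \in NL -> τ \in NL -> node_width P σ <= g -> node_width P τ <= g ->
  u \in node_pts P σ -> v \in node_pts P τ -> dist u v <= 2 * g ->
  sp_le E0 u v (10 * t' * g).
Proof.
move=> σNL τNL σg τg uσ vτ uvg.
have [_ [lσ _]] := NL_greedy σNL; have [_ [lτ _]] := NL_greedy τNL.
have t'1 := lt_le_trans t_gt1 le_tt'.
have ldist : sp_le E0 (lead σ) (lead τ) (t' * dist (lead σ) (lead τ)).
  apply: (@sp_le_sub F); first by move=> e eF; rewrite mem_cat eF orbT.
  by apply: wspd_spanner_spans F_spanner _ _; rewrite ?mem_undup ?map_f.
apply: sp_le_weaken (sp_le_trans (leaf_spans σNL uσ lσ)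
  (sp_le_trans ldist (leaf_spans τNL lτ vτ))).
have := node_pts_dist uσ lσ; have := node_pts_dist lτ vτ.
have := dist_triangle u (lead σ) (lead τ); have := dist_triangle v u (lead τ).
rewrite (dist_sym (lead σ) u) (dist_sym v (lead τ)).
have := dist_ge0 u (lead σ); have := dist_ge0 (lead τ) v => *.
have l6 : dist (lead σ) (lead τ) <= 6 * g by lra.
have l1 : dist u (lead σ) <= 2 * g by lra.
have l2 : dist (lead τ) v <= 2 * g by lra.
have b1 : t * dist u (lead σ) <= t' * (2 * g) by rewrite ler_pM // ltW // (lt_trans ltr01).
have b2 : t * dist (lead τ) v <= t' * (2 * g) by rewrite ler_pM // ltW // (lt_trans ltr01).
have b3 : t' * dist (lead σ) (lead τ) <= t' * (6 * g).
  by rewrite ler_wpM2l // ltW // (lt_trans ltr01).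
by lra.
Qed.

(* The box of side [g] containing [u] in the grid anchored at [c], together with
   either [None], for a leaf narrower than [g], or a corner of the box that
   pins down the leaf containing [u]. *)
Definition side_label (K : nat) c g u
    (l : 'I_(2 * K).+1 * 'I_(2 * K).+1 * option (bool * bool)) : Prop :=
  let o := (c.1 - K%:R * g + l.1.1%:R * g, c.2 - K%:R * g + l.1.2%:R * g) in
  [/\ o.1 <= u.1 <= o.1 + g, o.2 <= u.2 <= o.2 + g &
    exists2 σ, σ \in NL & u \in node_pts P σ /\
      if l.2 is Some b then in_node P σ (o.1 + b.1%:R * g, o.2 + b.2%:R * g)
      else node_width P σ <= g].

Lemma grid_coord (K : nat) (x y g : R) : 0 < g -> `|x - y| <= K%:R * g ->
  exists i : 'I_(2 * K).+1,
    y - K%:R * g + i%:R * g <= x <= y - K%:R * g + i%:R * g + g.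
Proof.
move=> g0; rewrite ler_norml => /andP[lo hi].
set z := (x - (y - K%:R * g)) / g.
have xE : x = y - K%:R * g + z * g by rewrite /z; field; rewrite gt_eqF.
have z0 : 0 <= z by rewrite divr_ge0 ?(ltW g0) //; lra.
(* [z] may equal [2 * K], hence [2 * K + 1] boxes per axis. *)
have zK : (Num.truncn z < (2 * K).+1)%N.
  rewrite ltnS truncn_le_nat -natr1 (@le_lt_trans _ _ (2 * K)%:R) ?ltrDl ?ltr01 //.
  by rewrite natrM ler_pdivrMr //; lra.
have /andP[zl zu] := truncn_itv z0; rewrite -natr1 in zu.
have lo' : (Num.truncn z)%:R * g <= z * g by rewrite ler_pM2r.
have hi' : z * g <= ((Num.truncn z)%:R + 1) * g by rewrite ler_pM2r // ltW.
by exists (Ordinal zK); rewrite /= xE; apply/andP; lra.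
Qed.

Lemma side_label_exists (K : nat) c g u σ : 0 < g -> dist u c <= K%:R * g ->
  σ \in NL -> u \in node_pts P σ -> exists l, @side_label K c g u l.
Proof.
move=> g0 uc σNL uσ; have [uc1 uc2] := ler_coord_dist u c.
have [i iP] := grid_coord g0 (le_trans uc1 uc).
have [j jP] := grid_coord g0 (le_trans uc2 uc).
have [small|/ltW big] := leP (node_width P σ) g.
  by exists (i, j, None); split=> //; exists σ.
have uin : in_node P σ u by move: uσ; rewrite mem_filter => /andP[].
have [b1 [b2 b12]] := in_node_corner (c := (_, _)) big uin iP jP.
by exists (i, j, Some (b1, b2)); split=> //; exists σ.
Qed.

(** A shared corner forces a common leaf, spanned by its greedy graph; without a corner both leaves
    are narrow and their leaders connect them. *)
Lemma side_label_close (K : nat) c g u v l :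
  @side_label K c g u l -> side_label c g v l ->
  dist u v <= 2 * g /\ sp_le E0 u v (10 * t' * g).
Proof.
rewrite /side_label /= => -[/andP[u1 u1'] /andP[u2 u2'] [σ σNL [uσ lσ]]].
move=> [/andP[v1 v1'] /andP[v2 v2'] [τ τNL [vτ lτ]]].
have uv : dist u v <= 2 * g.
  by apply: dist_le_coord; rewrite ler_norml; apply/andP; lra.
split=> //; case: l.2 lσ lτ => [[b1 b2] /= lσ lτ|lσ lτ]; last first.
  exact: small_leaves_span uσ vτ uv.
have στ := leaf_disjoint (NL_leaf σNL) (NL_leaf τNL) lσ lτ.
apply: sp_le_weaken (leaf_spans σNL uσ _); last by rewrite στ.
have t0 : 0 <= t by rewrite ltW // (lt_trans ltr01).
have le2 : t * dist u v <= t' * (2 * g) by rewrite ler_pM ?dist_ge0.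
(* [g] is nonnegative because [0 <= dist u v <= 2 * g]. *)
have := mulr_ge0 (le_trans t0 le_tt') (le_trans (dist_ge0 u v) uv); lra.
Qed.

Lemma merge_edges_bound (K : nat) (E : graph R) :
  8 * (40 * t' + 8) <= K%:R * (t - 1) ->
  (forall e, e \in E -> e.1 != e.2 /\ exists σ τ,
     [/\ σ \in NL, τ \in NL, e.1 \in node_pts P σ & e.2 \in node_pts P τ]) ->
  irredundant t E0 E ->
  (size E <= size P *
     #|{: ('I_(2 * K).+1 * 'I_(2 * K).+1 * option (bool * bool)) *
          ('I_(2 * K).+1 * 'I_(2 * K).+1 * option (bool * bool))}|)%N.
Proof.
move=> KP EP irr; have [rad radP] := ex_pair_scale P.
have t'1 := lt_le_trans t_gt1 le_tt'.
(* With [g = δ * rad c], a detour from [e'] through [e] has length at most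
   [dist e'.1 e'.2 + (20 * t' + 4) * g]. As [rad c <= 2 * dist e'.1 e'.2], this [δ] makes the excess
   at most [(t - 1) * dist e'.1 e'.2]. *)
pose δ := (t - 1) / (40 * t' + 8).
have d0 : 0 < 40 * t' + 8 by lra.
have δ0 : 0 < δ by rewrite divr_gt0 // subr_gt0.
have δE : (40 * t' + 8) * δ = t - 1 by rewrite /δ; field; rewrite gt_eqF.
have Kδ : 8 <= K%:R * δ by rewrite /δ mulrA ler_pdivlMr.
pose L1 : finType := ('I_(2 * K).+1 * 'I_(2 * K).+1 * option (bool * bool))%type.
pose label (e : pt R * pt R) (l : pt R * (L1 * L1)) :=
  [/\ l.1 \in P, rad l.1 <= 2 * dist e.1 e.2,
    side_label l.1 (δ * rad l.1) e.1 l.2.1 & side_label l.1 (δ * rad l.1) e.2 l.2.2].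
have [e /EP[e12 [σ [τ [σNL τNL eσ eτ]]]]|e e' H l _ _ eL e'L eH E0H|ks [uks <- ksP]] :=
    @irredundant_labels t E0 E _ label _ _ irr.
- have eP1 : e.1 \in P by move: eσ; rewrite mem_filter => /andP[].
  have eP2 : e.2 \in P by move: eτ; rewrite mem_filter => /andP[].
  have [c cP [rl ru d1 d2]] := radP _ _ eP1 eP2 e12.
  have L0 : 0 < dist e.1 e.2 by rewrite dist_gt0.
  have rad0 : 0 < rad c by lra.
  have g0 : 0 < δ * rad c by rewrite mulr_gt0.
  (* Since [dist e.1 e.2 <= 4 * rad c], the grid around [c] reaches both endpoints, which lie within
     [2 * dist e.1 e.2] of [c]. *)
  have Kg : 8 * rad c <= K%:R * (δ * rad c) by rewrite mulrA ler_pM2r.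
  have le2 : 2 * dist e.1 e.2 <= K%:R * (δ * rad c) by lra.
  have [l1 l1P] := side_label_exists g0 (le_trans d1 le2) σNL eσ.
  have [l2 l2P] := side_label_exists g0 (le_trans d2 le2) τNL eτ.
  by exists (c, (l1, l2)).
- have [_ _ e1 e2] := eL; have [_ r' e1' e2'] := e'L.
  have [d1 /(sp_le_sub E0H) p1] := side_label_close e1' e1.
  have [d2 /(sp_le_sub E0H) p2] := side_label_close e2 e2'.
  have p12 : sp_le H e.1 e.2 (dist e.1 e.2).
    by apply: sp_le_edge; rewrite /adj -surjective_pairing eH.
  apply: sp_le_weaken (sp_le_trans p1 (sp_le_trans p12 p2)).
  have t1g : (40 * t' + 8) * (δ * rad l.1) <= (t - 1) * (2 * dist e'.1 e'.2).
    by rewrite mulrA δE ler_wpM2l // subr_ge0 ltW.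
  have tri1 := dist_triangle e'.1 e.1 e.2; have tri2 := dist_triangle e'.2 e'.1 e.2.
  rewrite (dist_sym e.1 e'.1) in tri1; rewrite (dist_sym e'.2 e.2) in tri2.
  by lra.
rewrite -(size_map id ks) cardE -(size_allpairs pair).
apply: uniq_leq_size; first by rewrite map_id.
move=> [c ll]; rewrite map_id => /ksP[e _ [/= cP _ _ _]].
by apply/allpairsP; exists (c, ll); rewrite mem_enum.
Qed.
End Run.
End SpannerSize.

(* For fixed t > 1, t' >= t, positive integers k, h (and the linear-size
   guarantee cW of the WSPD construction), there is a constant C such that
   every output H of Fast-Sparse-Spanner(P,t,t',k,h) on any set P of n points
   is a geometric graph on P with at most C * n edges. *)
Theorem theorem1 (R : realType) (t t' : R) (k h : nat) (cW : R) :
  1 < t -> t <= t' -> (0 < k)%N -> (0 < h)%N ->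
  exists C : R, forall (P : seq (pt R)) (H : graph R),
    uniq P -> fss_output t t' k h cW P H ->
    geometric_graph_on P H /\ (num_edges P H)%:R <= C * (size P)%:R.
Proof.
move=> t1 tt' _ _.
(* [K] depends on [t] and [t'] only, so the number [B] of label pairs per point is constant. *)
pose x : R := 8 * (40 * t' + 8) / (t - 1); pose K := (Num.truncn x).+1.
have KP : 8 * (40 * t' + 8) <= K%:R * (t - 1).
  by rewrite -ler_pdivrMr ?subr_gt0 // ltW // truncnS_gt.
pose B := #|{: ('I_(2 * K).+1 * 'I_(2 * K).+1 * option (bool * bool)) *
          ('I_(2 * K).+1 * 'I_(2 * K).+1 * option (bool * bool))}|.
(* The summands account for merging, leaf spanners and the WSPD. The maximum with 0 allows replacing
   the number of leaders by [size P] whatever the sign of [cW]. *)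
exists (B%:R + (k * k)%:R + Num.max cW 0) => P H uP.
move=> [NL [lead [Gr [W [F [M [[uNL NLE] NLG [WF szW] [MNL _ _] run]]]]]]].
have NL_leaf (σ : node) : σ \in NL -> is_leaf P k σ by rewrite NLE => /andP[].
have NL_small (σ : node) : σ \in NL -> (size (node_pts P σ) <= k)%N.
  by move/NL_leaf => /andP[].
have lead_in (σ : node) : σ \in NL -> lead σ \in node_pts P σ by move=> /NLG[_ []].
have sub_P (σ : node) p : p \in node_pts P σ -> p \in P by rewrite mem_filter => /andP[].
have in_σ (σ : node) p : p \in node_pts P σ -> in_node P σ p by rewrite mem_filter => /andP[].
(* Leaves are disjoint, so distinct leaves have distinct leaders; hence at most [size P] leaves are
   non-empty. *)
have lead_inj : {in NL &, injective lead}.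
  move=> σ τ σNL τNL στ.
  apply: (leaf_disjoint (NL_leaf _ σNL) (NL_leaf _ τNL) (in_σ _ _ (lead_in _ σNL))).
  by rewrite στ in_σ ?lead_in.
have leadersP : {subset [seq lead σ | σ <- NL] <= P}.
  by move=> p /mapP[σ σNL ->]; apply: sub_P (lead_in _ σNL).
have [E [HE irr EM]] := merges_run_irredundant run.
have EP e : e \in E -> e.1 != e.2 /\ exists σ τ,
     [/\ σ \in NL, τ \in NL, e.1 \in node_pts P σ & e.2 \in node_pts P τ].
  move=> /EM[[σ τ] /MNL[/= σNL τNL στ _] [eσ eτ]]; split; last by exists σ, τ.
  apply: contra_neq στ => e12.
  apply: (leaf_disjoint (NL_leaf _ σNL) (NL_leaf _ τNL) (in_σ _ _ eσ)).
  by rewrite e12 in_σ.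
have szE := merge_edges_bound t1 tt' NL_leaf NLG WF KP EP irr.
have szNL : (size NL <= size P)%N.
  rewrite -(size_map lead); apply: uniq_leq_size => //.
  by rewrite map_inj_in_uniq.
have szS : (size (undup [seq lead σ | σ <- NL]) <= size P)%N.
  by rewrite (leq_trans (size_undup _)) // size_map.
have szG : (size (flatten [seq Gr σ | σ <- NL]) <= k * k * size P)%N.
  apply: leq_trans (_ : k * k * size NL <= _)%N; last by rewrite leq_mul2l szNL orbT.
  elim: (NL) (fun σ => @NLG σ) NL_small => [|σ NL' IH] //= grd small.
  rewrite size_cat mulnS leq_add //; last first.
    by apply: IH => τ τNL; [apply: grd | apply: small]; rewrite inE τNL orbT.
  have [_ /leq_trans] := fg_greedy_sub (grd _ (mem_head _ _)).1; apply.
  by rewrite leq_mul ?small ?mem_head.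
have szF : (size F)%:R <= Num.max cW 0 * (size P)%:R.
  have <- : size W = size F.
    by case: WF => _; elim: (W) (F) => [|? ? IH] [|? ?] //= /andP[_ /IH ->].
  rewrite (le_trans szW) // (@le_trans _ _ (Num.max cW 0 * (size (undup [seq lead σ | σ <- NL]))%:R)) //.
    by rewrite ler_wpM2r // le_max lexx.
  by rewrite ler_wpM2l ?ler_nat // le_max lexx orbT.
split.
  move=> e; rewrite HE !mem_cat => /or3P[/EP[e12 [σ [τ [_ _ eσ eτ]]]]|/flatten_mapP[σ σNL eG]|eF].
  - by split; rewrite ?(sub_P _ _ eσ) ?(sub_P _ _ eτ).
  - have [/(_ _ eG) eP _] := fg_greedy_sub (NLG _ σNL).1.
    have [e1 e2] := pairs_of_sub eP; split; [exact: sub_P e1 | exact: sub_P e2 |].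
    by apply: pairs_of_neq eP; apply: filter_uniq.
  - have [+ + e12] := wspd_spanner_edge WF eF.
    by rewrite !mem_undup => /leadersP e1 /leadersP e2.
apply: (@le_trans _ _ (size H)%:R); first by rewrite ler_nat num_edges_le.
rewrite HE !size_cat !natrD addrA !mulrDl !lerD //.
  by rewrite -natrM ler_nat mulnC.
by rewrite -natrM ler_nat.
Qed.
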